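(* Let $n\ge1$ and $-\infty\le\alpha\le0$. If $f,g\in \mathrm{C}_\alpha(\mathbb{R}^n)$, then $f\oplus g\in \mathrm{C}_\alpha(\mathbb{R}^n)$.
   Context: For $-\infty\le\alpha\le0$, $\mathrm{C}_\alpha(\mathbb{R}^n)$ is the class of functions $f:\mathbb{R}^n\to[0,\infty)$ that are upper semicontinuous, satisfy $\max_{x\in\mathbb{R}^n} f(x)=1$ and $f(x)\to0$ as $|x|\to\infty$, and are $\alpha$-concave: $f$ is supported on some convex set $\Omega$ (it vanishes outside $\Omega$) and for all $x,y\in\Omega$, $0\le\lambda\le1$, $$f(\lambda x+(1-\lambda)y)\ge\left[\lambda f(x)^\alpha+(1-\lambda)f(y)^\alpha\right]^{1/\alpha}.$$ The cases $\alpha=0$ and $\alpha=-\infty$ are understood in the limit sense: for $\alpha=0$ (log-concave) the right-hand side is $f(x)^\lambda f(y)^{1-\lambda}$, and for $\alpha=-\infty$ (quasi-concave) it is $\min\{f(x),f(y)\}$. For $-\infty<\alpha<0$, $\alpha$-concavity is equivalent to convexity of $f^\alpha:\mathbb{R}^n\to(0,\infty]$ (with $0^\alpha=\infty$). The quasi-sum is $(f\oplus g)(x)=\sup_{y+z=x}\min\{f(y),g(z)\}$. *)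

(* Defs.v *)
From HB Require Import structures.
From mathcomp Require Import all_boot all_order all_algebra.
From mathcomp Require Import all_classical all_reals all_analysis.
Import Order.TTheory GRing.Theory Num.Theory.
Import numFieldNormedType.Exports.

Set Implicit Arguments.
Unset Strict Implicit.
Unset Printing Implicit Defensive.

Local Open Scope classical_set_scope.
Local Open Scope ring_scope.

(* Euclidean norm; the library norm on 'rV[R]_n is the sup norm. *)
Definition enorm (R : realType) (n : nat) (x : 'rV[R]_n) : R :=
  Num.sqrt (\sum_(i < n) x ord0 i ^+ 2).

(* Real-valued mirror image of the library's lower_semicontinuous. *)
Definition upper_semicontinuous (R : realType) (X : topologicalType)
    (f : X -> R) : Prop :=
  forall (x : X) (a : R), f x < a -> \forall y \near x, f y < a.

Definition vanishes_at_infinity (R : realType) (n : nat) (f : 'rV[R]_n -> R) :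
    Prop :=
  forall eps : R, 0 < eps ->
    exists M : R, forall x : 'rV[R]_n, M < enorm x -> `|f x| < eps.

(* s ^ a for a < 0 and s in [0, +oo], with 0 ^ a = +oo and (+oo) ^ a = 0.
   A negative exponent cannot be given to poweR directly, because the library
   sets 0 `^ a = 0 for every a != 0. *)
Definition neg_power (R : realType) (a : R) (s : \bar R) : \bar R :=
  ((s `^ (- a))^-1)%E.

(* The mean [l s^alpha + (1 - l) t^alpha]^(1/alpha) for s, t >= 0 and
   alpha <= 0, with its limits at alpha = 0 and alpha = -oo. For alpha < 0 the
   sum is taken in [0, +oo], where 0 * +oo = 0: the mean is t at l = 0, s at
   l = 1, and 0 when 0 < l < 1 and s or t is 0. The branch +oo is not used. *)
Definition alpha_mean (R : realType) (alpha : \bar R) (l s t : R) : \bar R :=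
  match alpha with
  | a%:E =>
      if a == 0 then (s `^ l * t `^ (1 - l))%:E
      else neg_power a^-1
             (l%:E * neg_power a s%:E + (1 - l)%:E * neg_power a t%:E)%E
  | -oo%E => (Num.min s t)%:E
  | +oo%E => (Num.max s t)%:E
  end.

Definition alpha_concave (R : realType) (n : nat) (alpha : \bar R)
    (f : 'rV[R]_n -> R) : Prop :=
  exists Omega : set 'rV[R]_n,
    [/\ convex_set Omega,
        forall x, ~ Omega x -> f x = 0
      & forall (x y : 'rV[R]_n) (l : R),
          Omega x -> Omega y -> 0 <= l <= 1 ->
          (alpha_mean alpha l (f x) (f y) <= (f (l *: x + (1 - l) *: y))%:E)%E].

(* The class C_alpha(R^n), for -oo <= alpha <= 0. *)
Record C_class (R : realType) (n : nat) (alpha : \bar R)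
    (f : 'rV[R]_n -> R) : Prop := {
  C_ge0 : forall x, 0 <= f x;
  C_usc : upper_semicontinuous f;
  C_max : (exists x, f x = 1) /\ (forall x, f x <= 1);
  C_vanish : vanishes_at_infinity f;
  C_concave : alpha_concave alpha f }.

(* The real supremum is genuine for members of C_class: the set is nonempty and
   bounded above by 1. *)
Definition quasi_sum (R : realType) (n : nat) (f g : 'rV[R]_n -> R)
    (x : 'rV[R]_n) : R :=
  sup [set Num.min (f p.1) (g p.2) | p in [set p | p.1 + p.2 = x]].

(* Main.v *)
Require Import Defs.
From mathcomp Require Import all_boot all_order all_algebra.
From mathcomp Require Import all_classical all_reals all_analysis.

Import Order.TTheory GRing.Theory Num.Theory.
Import numFieldNormedType.Exports.

Set Implicit Arguments.
Unset Strict Implicit.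
Unset Printing Implicit Defensive.

Local Open Scope classical_set_scope.
Local Open Scope ring_scope.

(** The proof rests on two observations about h = f (+) g.

    Since f is upper semicontinuous and tends to 0 at infinity, the supremum
    defining h x is a maximum ([quasi_sum_attained]).  Hence, for a > 0, the
    superlevel set {h >= a} is exactly the Minkowski sum {f >= a} + {g >= a}.
    A nonnegative function is upper semicontinuous and vanishes at infinity if
    and only if its superlevel sets at positive heights are compact
    ([compact_superlevel], [superlevel_compact_usc],
    [superlevel_compact_vanishes]), and a sum of two compact sets is compact.
    So both topological conditions pass from f and g to h at once.

    For the concavity, let A and B be convex sets carrying f and g; then A + B
    carries h.  For x and x' in A + B take maximizing decompositions
    x = y + z and x' = y' + z' along A and B.  As h x <= f y and h x' <= f y',
    and as the alpha-mean is nondecreasing in its two values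
    ([alpha_mean_le]), the mean of h x and h x' is at most
    f (l y + (1 - l) y'), and likewise at most g (l z + (1 - l) z').  The
    smaller of these two numbers is at most h (l x + (1 - l) x'), because
    l x + (1 - l) x' is the sum of the two points. *)

Lemma norm_le_enorm (R : realType) (n : nat) (x : 'rV[R]_n) :
  `|x| <= enorm x.
Proof.
rewrite [`|x|]mx_normrE; apply: bigmax_le => [|[i j] _ /=].
  exact: sqrtr_ge0.
rewrite (ord1 i) -sqrtr_sqr ler_wsqrtr// (bigD1 j)//= lerDl.
by apply: sumr_ge0 => k _; exact: sqr_ge0.
Qed.

(** Together with [norm_le_enorm], this is all that is needed to pass between
    the Euclidean norm and the topology, which is given by the sup norm. *)
Lemma enorm_continuous (R : realType) (n : nat) :
  continuous (@enorm R n).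
Proof.
move=> x; apply: (@continuous_comp _ _ _ (fun y : 'rV[R]_n =>
  \sum_(i < n) y ord0 i ^+ 2) Num.sqrt); last exact: sqrt_continuous.
apply: (@continuous_big _ _ _ _ _ add_continuous) => i _ {}x.
apply: (@continuous_comp _ _ _
  (fun y : 'rV[R]_n => y ord0 i) (fun t => t ^+ 2)).
  exact: coord_continuous.
exact: exprn_continuous.
Qed.

Lemma usc_superlevel_closed (R : realType) (X : topologicalType) (f : X -> R)
    (a : R) :
  upper_semicontinuous f -> closed [set x | a <= f x].
Proof.
move=> uscf; rewrite -[X in closed X]setCK; apply: open_closedC.
rewrite openE => x /= /negP; rewrite -ltNge => /uscf.
by apply: filterS => y fy /=; apply/negP; rewrite -ltNge.
Qed.

(** Decay at infinity bounds the superlevel set, upper semicontinuity closes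
    it, and Heine-Borel concludes.  The height has to be positive: at height 0
    the superlevel set of a nonnegative function is the whole space. *)
Lemma compact_superlevel (R : realType) (n : nat) (f : 'rV[R]_n -> R) (a : R) :
  upper_semicontinuous f -> vanishes_at_infinity f -> 0 < a ->
  compact [set x | a <= f x].
Proof.
move=> uscf vanf a0; apply: bounded_closed_compact; last first.
  exact: usc_superlevel_closed.
have [M fM] := vanf a a0.
exists M; split; first exact: num_real.
move=> N MN x /= afx; rewrite leNgt; apply/negP => Nx.
have /fM : M < enorm x := lt_le_trans (lt_trans MN Nx) (norm_le_enorm x).
by rewrite ltNge (le_trans afx (ler_norm _)).
Qed.

(** Nonnegativity makes [{f < a}] empty for a <= 0, so only the compact, hence
    closed, superlevel sets at positive heights matter. *)
Lemma superlevel_compact_usc (R : realType) (n : nat) (f : 'rV[R]_n -> R) :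
  (forall x, 0 <= f x) ->
  (forall a, 0 < a -> compact [set x | a <= f x]) -> upper_semicontinuous f.
Proof.
move=> f0 cf x a fxa.
have a0 : 0 < a := le_lt_trans (f0 x) fxa.
have : open (~` [set y | a <= f y]).
  apply: closed_openC; apply: compact_closed (cf a a0).
  exact: norm_hausdorff.
have -> : ~` [set y | a <= f y] = [set y | f y < a].
  by apply/seteqP; split => y /=; rewrite ltNge => /negP.
by rewrite openE => /(_ x fxa).
Qed.

(** The continuous function [enorm] is bounded on the compact set
    [{f >= eps}]; beyond that bound f is below eps. *)
Lemma superlevel_compact_vanishes (R : realType) (n : nat)
    (f : 'rV[R]_n -> R) :
  (forall x, 0 <= f x) ->
  (forall a, 0 < a -> compact [set x | a <= f x]) -> vanishes_at_infinity f.
Proof.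
move=> f0 cf eps eps0.
have : compact (@enorm R n @` [set x | eps <= f x]).
  apply: continuous_compact; last exact: cf.
  exact/continuous_subspaceT/enorm_continuous.
move=> /compact_bounded [M [_ bM]]; exists (M + 1) => x Mx.
rewrite ger0_norm// ltNge; apply/negP => fx.
have /= := bM (M + 1); rewrite ltrDl ltr01 => /(_ isT (enorm x)).
move=> /(_ (ex_intro2 _ _ x fx erefl)).
by rewrite leNgt (lt_le_trans Mx)// ler_norm.
Qed.

(** The superlevel sets of u at the heights u z, with z in K, form a chain of
    nonempty subsets of K, hence generate a proper filter.  By compactness it
    has a cluster point c in K; were u c < u z for some z in K, upper
    semicontinuity would separate c from the superlevel set at height u z. *)
Lemma usc_attains_max (R : realType) (X : topologicalType) (u : X -> R)
    (K : set X) :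
  upper_semicontinuous u -> compact K -> K !=set0 ->
  exists2 c, K c & forall y, K y -> u y <= u c.
Proof.
move=> uscu cK [x0 Kx0].
pose F := filter_from K (fun z => K `&` [set y | u z <= u y]).
have FF : ProperFilter F.
  apply: filter_from_proper; last by move=> z Kz; exists z; split => /=.
  apply: filter_from_filter; first by exists x0.
  move=> i j Ki Kj; have [ij|ji] := leP (u i) (u j).
    by exists j => // y [Ky jy]; do 2!split => //=; exact: le_trans jy.
  exists i => // y [Ky iy]; do 2!split => //=.
  exact: le_trans (ltW ji) iy.
have FK : F K by exists x0 => // y [].
have [c [Kc clc]] := cK F FF FK.
exists c => // z Kz; rewrite leNgt; apply/negP => cz.
have Fz : F (K `&` [set y | u z <= u y]) by exists z.
have [y [[_ /= zy] /= yz]] := clc _ _ Fz (uscu c _ cz).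
by move: yz; rewrite ltNge zy.
Qed.

Lemma usc_min (R : realType) (X : topologicalType) (u v : X -> R) :
  upper_semicontinuous u -> upper_semicontinuous v ->
  upper_semicontinuous (fun x => Num.min (u x) (v x)).
Proof.
move=> uscu uscv x a; rewrite gt_min => /orP[/uscu|/uscv]; apply: filterS => y;
  by rewrite gt_min => ->; rewrite ?orbT.
Qed.

Lemma usc_comp (R : realType) (X Y : topologicalType) (k : X -> Y)
    (u : Y -> R) :
  continuous k -> upper_semicontinuous u -> upper_semicontinuous (u \o k).
Proof. by move=> ck uscu x a /uscu; exact: ck. Qed.

Lemma quasi_sum_max (R : realType) (n : nat) (f g : 'rV[R]_n -> R)
    (y z : 'rV[R]_n) :
  (forall y' z', y' + z' = y + z ->
     Num.min (f y') (g z') <= Num.min (f y) (g z)) ->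
  quasi_sum f g (y + z) = Num.min (f y) (g z).
Proof.
move=> yz_max; apply/eqP; rewrite eq_le; apply/andP; split.
  apply: ge_sup; first by exists (Num.min (f y) (g z)), (y, z).
  by move=> _ [[y' z'] /= /yz_max ? <-].
apply: ub_le_sup; last by exists (y, z).
by exists (Num.min (f y) (g z)) => _ [[y' z'] /= /yz_max ? <-].
Qed.

(** For fixed x, the function [u y = min (f y) (g (x - y))] is upper
    semicontinuous and nonnegative.  If it is positive at some y0, a maximum
    over the compact set [{f >= u y0}] is a global maximum, as u <= f < u y0
    elsewhere.  Otherwise u vanishes identically and every point is a
    maximum. *)
Lemma quasi_sum_attained (R : realType) (n : nat) (f g : 'rV[R]_n -> R) :
  (forall x, 0 <= f x) -> (forall x, 0 <= g x) ->
  upper_semicontinuous f -> upper_semicontinuous g ->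
  vanishes_at_infinity f ->
  forall x, exists y z, [/\ y + z = x,
    quasi_sum f g x = Num.min (f y) (g z) &
    forall y' z', y' + z' = x -> Num.min (f y') (g z') <= quasi_sum f g x].
Proof.
move=> f0 g0 uscf uscg vanf x.
pose u y := Num.min (f y) (g (x - y)).
suff [y uy] : exists y, forall y', u y' <= u y.
  have yz_max y' z' : y' + z' = y + (x - y) ->
      Num.min (f y') (g z') <= Num.min (f y) (g (x - y)).
    rewrite subrKC => yz.
    have -> : z' = x - y' by rewrite -yz addrAC subrr add0r.
    exact: uy.
  have := quasi_sum_max yz_max; rewrite subrKC => hx.
  exists y, (x - y); split=> //; first by rewrite subrKC.
  by move=> y' z' yz; rewrite hx; apply: yz_max; rewrite subrKC.
have [[y0 u0]|u0] := pselect (exists y, 0 < u y); last first.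
  exists 0 => y; apply: (@le_trans _ _ 0); last by rewrite le_min f0 g0.
  by rewrite leNgt; apply/negP => uy; apply: u0; exists y.
have uscu : upper_semicontinuous u.
  have ck : continuous (fun y : 'rV[R]_n => (x : 'rV[R]_n) - y).
    move=> y; apply: (@continuousB _ _ _ (cst x) id); last exact: cvg_id.
    exact: cst_continuous.
  exact: usc_min uscf (usc_comp ck uscg).
have [|c _ cmax] := usc_attains_max uscu (compact_superlevel uscf vanf u0).
  by exists y0 => /=; rewrite ge_min lexx.
exists c => y; have [|fy] := leP (u y0) (f y); first exact: cmax.
apply: (@le_trans _ _ (u y0)); first by rewrite ge_min (ltW fy).
by apply: cmax; rewrite /= ge_min lexx.
Qed.

Lemma neg_power_anti (R : realType) (r : R) (s t : \bar R) :
  r <= 0 -> (0 <= s)%E -> (s <= t)%E -> (neg_power r t <= neg_power r s)%E.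
Proof.
move=> r0 s0 st; rewrite /neg_power lee_pV2 ?inE ?poweR_ge0//.
apply: gt0_ler_poweR => //; first by rewrite oppr_ge0.
  by rewrite in_itv/= s0 leey.
by rewrite in_itv/= (le_trans s0 st) leey.
Qed.

Lemma neg_power_ge0 (R : realType) (r : R) (s : \bar R) :
  (0 <= neg_power r s)%E.
Proof. by rewrite /neg_power inve_ge0 poweR_ge0. Qed.

(** For a negative exponent, the mean is a decreasing power of a nonnegative
    combination of decreasing powers, so it is nondecreasing; this fails for
    [neg_power] with a positive exponent, whence the sign condition on
    alpha. *)
Lemma alpha_mean_le (R : realType) (alpha : \bar R) (l s t s' t' : R) :
  (alpha <= 0)%E -> 0 <= l <= 1 -> 0 <= s -> 0 <= t -> s <= s' -> t <= t' ->
  (alpha_mean alpha l s t <= alpha_mean alpha l s' t')%E.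
Proof.
case: alpha => [a||]//= + /andP[l0 l1] s0 t0 ss tt; last first.
  by move=> _; rewrite lee_fin le_min !ge_min ss tt orbT.
have l1' : 0 <= 1 - l by rewrite subr_ge0.
have s'0 := le_trans s0 ss; have t'0 := le_trans t0 tt.
rewrite lee_fin; case: eqP => [_ _|_ a0].
  by rewrite lee_fin ler_pM ?powR_ge0// ge0_ler_powR.
apply: neg_power_anti; first by rewrite invr_le0.
  by rewrite adde_ge0 ?mule_ge0 ?neg_power_ge0 ?lee_fin.
by rewrite leeD// lee_wpmul2l ?lee_fin// neg_power_anti ?lee_fin.
Qed.

Lemma convex_set_add (R : realType) (n : nat) (A B : set 'rV[R]_n) :
  convex_set A -> convex_set B ->
  convex_set [set y + z | y in A & z in B].
Proof.
move=> cA cB x x' l; rewrite !inE.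
move=> [y Ay [z Bz <-]] [y' Ay' [z' Bz' <-]].
exists (conv l (y : convex_lmodType 'rV[R]_n) y').
  by have := cA y y' l; rewrite !inE; apply.
exists (conv l (z : convex_lmodType 'rV[R]_n) z').
  by have := cB z z' l; rewrite !inE; apply.
by rewrite /conv/= !scalerDr addrACA.
Qed.

Theorem theorem9 (R : realType) (n : nat) (hn : (1 <= n)%N)
  (alpha : \bar R) (halpha : (alpha <= 0)%E)
  (f g : 'rV[R]_n -> R)
  (hf : C_class alpha f) (hg : C_class alpha g) :
  C_class alpha (quasi_sum f g).
Proof.
case: hf => f0 uscf [[y1 fy1] f1] vanf [A [cA A0 fA]].
case: hg => g0 uscg [[z1 gz1] g1] vang [B [cB B0 gB]].
have hsum := quasi_sum_attained f0 g0 uscf uscg vanf.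
set h := quasi_sum f g in hsum *.
have h_ge y z : Num.min (f y) (g z) <= h (y + z).
  by have [_ [_ [_ _ ]]] := hsum (y + z); apply.
have h0 x : 0 <= h x.
  by have [y [z [_ -> _]]] := hsum x; rewrite le_min f0 g0.
have h1 x : h x <= 1.
  by have [y [z [_ -> _]]] := hsum x; rewrite ge_min f1.
have ch a : 0 < a -> compact [set x | a <= h x].
  move=> a0.
  have -> : [set x | a <= h x] =
      (fun p => p.1 + p.2) @` ([set y | a <= f y] `*` [set z | a <= g z]).
    apply/seteqP; split=> [x /=|_ [[y z] /= [fy gz] <-]].
      have [y [z [<- -> _]]] := hsum x; rewrite le_min => /andP[fy gz].
      by exists (y, z).
    by apply: le_trans (h_ge y z); rewrite le_min fy gz.
  apply: continuous_compact; last first.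
    by apply: compact_setX; exact: compact_superlevel.
  by apply: continuous_subspaceT; exact: add_continuous.
split=> //.
- exact: superlevel_compact_usc.
- split=> //; exists (y1 + z1); apply/eqP; rewrite eq_le h1/=.
  by apply: le_trans (h_ge y1 z1); rewrite fy1 gz1 minxx.
- exact: superlevel_compact_vanishes.
exists [set y + z | y in A & z in B]; split.
- exact: convex_set_add.
- move=> x ABx; have [y [z [yz -> _]]] := hsum x.
  have [Ay|/A0 ->] := pselect (A y); last by rewrite min_l.
  have [Bz|/B0 ->] := pselect (B z); last by rewrite min_r.
  by exfalso; apply: ABx; exists y => //; exists z.
(* The maximizing decomposition lies along A and B unless one of its two values
   is 0; then h x = 0 and any decomposition along A and B will do. *)
have hAB x : [set y + z | y in A & z in B] x ->
    exists y z, [/\ A y, B z, y + z = x & h x <= Num.min (f y) (g z)].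
  move=> [y' Ay' [z' Bz' yz']]; have [y [z [yz hx _]]] := hsum x.
  have [Ay|/A0 fy] := pselect (A y); last first.
    by exists y', z'; split=> //; rewrite hx fy (min_l (g0 z)) le_min f0 g0.
  have [Bz|/B0 gz] := pselect (B z); last first.
    by exists y', z'; split=> //; rewrite hx gz (min_r (f0 y)) le_min f0 g0.
  by exists y, z; split=> //; rewrite hx.
move=> x x' l /hAB[y [z [Ay Bz <-]]] + /hAB[y' [z' [Ay' Bz' <-]]] + l01.
rewrite !le_min => /andP[hf hg] /andP[hf' hg'].
have -> : l *: (y + z) + (1 - l) *: (y' + z') =
    (l *: y + (1 - l) *: y') + (l *: z + (1 - l) *: z').
  by rewrite !scalerDr addrACA.
apply: (@le_trans _ _ (Num.min (f (l *: y + (1 - l) *: y'))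
                           (g (l *: z + (1 - l) *: z')))%:E); last first.
  by rewrite lee_fin h_ge.
rewrite EFin_min le_min; apply/andP; split.
  apply: le_trans (fA _ _ _ Ay Ay' l01).
  exact: alpha_mean_le hf hf'.
apply: le_trans (gB _ _ _ Bz Bz' l01).
exact: alpha_mean_le hg hg'.
Qed.
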